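(* Let $d(k)$ denote the number of positive divisors of the positive integer $k$ and let $\gamma$ be Euler's constant. For all real $q\in(0,1)$, $$\gamma\,\frac{q}{(1-q)^2}+\frac{\log(1-q)}{(1-q)\log(q)}<\sum_{k=1}^\infty\sum_{j=1}^k d(j)\,q^k<\frac{q}{(1-q)^2}+\frac{\log(1-q)}{(1-q)\log(q)}.$$ Moreover the constants are best possible: if $\lambda,\mu$ are real constants such that $\lambda\frac{q}{(1-q)^2}+\frac{\log(1-q)}{(1-q)\log(q)}<\sum_{k=1}^\infty\sum_{j=1}^k d(j)q^k<\mu\frac{q}{(1-q)^2}+\frac{\log(1-q)}{(1-q)\log(q)}$ for all $q\in(0,1)$, then $\lambda\le\gamma$ and $\mu\ge1$.
   Context: $\log$ denotes the natural logarithm. *)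

(* Defs.v *)
From Stdlib Require Import Reals Lra.
From Coquelicot Require Import Coquelicot.
From mathcomp Require seq prime.
Open Scope R_scope.

Definition num_divisors (k : nat) : nat := seq.size (prime.divisors k).

Definition harmonic (n : nat) : R := sum_n_m (fun k => / INR k) 1 n.

Definition euler_gamma : R := real (Lim_seq (fun n => harmonic n - ln (INR n))).

(* [Lim_seq] is total; the following lemmas show that [euler_gamma] is a genuine
   limit and not a default value. *)

Lemma harmonic_S (n : nat) : harmonic (S n) = harmonic n + / INR (S n).
Proof. unfold harmonic. rewrite sum_n_Sm; [reflexivity | auto with arith]. Qed.

Lemma ln_le_minus_1 (x : R) : 0 < x -> ln x <= x - 1.
Proof.
  intros Hx. destruct (Rle_or_lt (ln x) (x - 1)) as [H | H]; [exact H |].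
  generalize (exp_increasing _ _ H), (exp_ineq1_le (x - 1)).
  rewrite (exp_ln x Hx). lra.
Qed.

Lemma ln_step_upper (x : R) : 0 < x -> ln (x + 1) - ln x <= / x.
Proof.
  intros Hx. rewrite <- ln_div by lra.
  replace (/ x) with ((x + 1) / x - 1) by (field; lra).
  apply ln_le_minus_1, Rdiv_lt_0_compat; lra.
Qed.

Lemma ln_step_lower (x : R) : 0 < x -> / (x + 1) <= ln (x + 1) - ln x.
Proof.
  intros Hx.
  assert (H : ln (x / (x + 1)) <= x / (x + 1) - 1)
    by (apply ln_le_minus_1, Rdiv_lt_0_compat; lra).
  rewrite ln_div in H by lra.
  replace (x / (x + 1) - 1) with (- / (x + 1)) in H by (field; lra). lra.
Qed.

Lemma harmonic_lower (n : nat) : ln (INR (S n)) <= harmonic n.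
Proof.
  induction n as [| n IH].
  - simpl INR. rewrite ln_1. unfold harmonic.
    rewrite sum_n_m_zero by auto with arith. apply Rle_refl.
  - rewrite harmonic_S, (S_INR (S n)).
    generalize (ln_step_upper (INR (S n)) (lt_0_INR (S n) (Nat.lt_0_succ n))). lra.
Qed.

Lemma euler_gamma_is_lim :
  is_lim_seq (fun n => harmonic n - ln (INR n)) euler_gamma.
Proof.
  unfold euler_gamma. apply Lim_seq_correct'.
  cut (ex_finite_lim_seq (fun n => harmonic (S n) - ln (INR (S n)))).
  { intros [l Hl]. exists l. now apply is_lim_seq_incr_1. }
  apply (ex_finite_lim_seq_decr _ 0); intros n.
  - rewrite (harmonic_S (S n)), (S_INR (S n)).
    generalize (ln_step_lower (INR (S n)) (lt_0_INR (S n) (Nat.lt_0_succ n))). lra.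
  - generalize (harmonic_lower n), (harmonic_S n).
    generalize (Rinv_0_lt_compat _ (lt_0_INR (S n) (Nat.lt_0_succ n))). lra.
Qed.

(* Main.v *)
(* Put q = e^(-t) and f(x) = 1/(e^x - 1).  Multiplying by 1 - q turns the series into the
   Lambert series L = sum_n q^n/(1 - q^n) = sum_n f(nt), and ln(1-q)/ln q is the integral
   of f(xt) over [1, oo), so that L - ln(1-q)/ln q is the sum of the gaps
   D_n = f(nt) - int_n^(n+1) f(xt) dx.  As f decreases, 0 < D_n < f(nt) - f((n+1)t), which
   telescopes to the upper bound f(t) = q/(1-q).  Euler's constant is the sum of the
   corresponding gaps E_n for 1/x.  Since x^2 |f'(x)| = (x / (2 sinh(x/2)))^2 decreases, the
   monotone l'Hopital rule gives D_n >= c_n (f(nt) - f((n+1)t)) with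
   c_n = E_n / (1/n - 1/(n+1)).  The sequence c_n decreases and f(nt) <= f(t)/n, so Abel
   summation yields sum_n D_n > gamma f(t).  The constants are optimal because
   f(t)^(-1) sum_n D_n tends to gamma as t -> 0 and to 1 as t -> oo. *)

Require Import Defs.
From Stdlib Require Import Reals Lra Lia Psatz.
From Coquelicot Require Import Coquelicot.
From mathcomp Require ssrnat div seq prime.
Open Scope R_scope.

(** * Mean value theorems and the monotone l'Hopital rule *)

Lemma mean_value (f df : R -> R) (a b : R) :
  a < b -> (forall x, a <= x <= b -> is_derive f x (df x)) ->
  exists c, a < c < b /\ f b - f a = df c * (b - a).
Proof.
  intros Hab Hf.
  destruct (MVT_cor2 f df a b Hab) as [c [Hc1 Hc2]].
  - intros x Hx. apply is_derive_Reals, Hf, Hx.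
  - exists c. split; assumption.
Qed.

Lemma cauchy_mean_value (f g df dg : R -> R) (a b : R) :
  a < b ->
  (forall x, a <= x <= b -> is_derive f x (df x)) ->
  (forall x, a <= x <= b -> is_derive g x (dg x)) ->
  exists c, a < c < b /\ (f b - f a) * dg c = (g b - g a) * df c.
Proof.
  intros Hab Hf Hg.
  destruct (mean_value (fun x => (f b - f a) * g x - (g b - g a) * f x)
              (fun x => (f b - f a) * dg x - (g b - g a) * df x) a b Hab)
    as [c [Hc E]].
  - intros x Hx.
    apply (is_derive_minus (fun x => (f b - f a) * g x) (fun x => (g b - g a) * f x) x).
    + apply is_derive_scal, Hg, Hx.
    + apply is_derive_scal, Hf, Hx.
  - exists c. split; [exact Hc |].
    apply Rminus_diag_uniq, (Rmult_eq_reg_r (b - a)); [| lra].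
    rewrite Rmult_0_l, <- E. ring.
Qed.

(* Monotone l'Hopital rule: if [ddf / ddg] decreases, then so does [df / dg], hence
   [df b / dg b <= (f b - f a) / (g b - g a)]. *)
Lemma monotone_lhopital (f g df dg ddf ddg : R -> R) (a b : R) :
  a < b ->
  (forall x, a <= x <= b -> is_derive f x (df x)) ->
  (forall x, a <= x <= b -> is_derive g x (dg x)) ->
  (forall x, a <= x <= b -> is_derive df x (ddf x)) ->
  (forall x, a <= x <= b -> is_derive dg x (ddg x)) ->
  df a = 0 -> dg a = 0 ->
  (forall x, a < x < b -> 0 < ddg x) ->
  (forall x y, a < x -> x < y -> y < b -> ddf y * ddg x <= ddf x * ddg y) ->
  df b * (g b - g a) <= (f b - f a) * dg b.
Proof.
  intros Hab Hf Hg Hdf Hdg Fa Ga Hpos Hmon.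
  (* By Cauchy's theorem [df x / dg x] is the value of [ddf / ddg] at some [c1 < x], and the
     quotient of the increments over [[x, b]] is its value at some [c2 > x]. The latter is no
     larger, so adding the increments can only lower the quotient. *)
  assert (Hr : forall x, a < x < b -> df b * dg x <= df x * dg b).
  { intros x Hx.
    destruct (cauchy_mean_value df dg ddf ddg a x) as [c1 [Hc1 E1]];
      [lra | intros; apply Hdf; lra | intros; apply Hdg; lra |].
    destruct (cauchy_mean_value df dg ddf ddg x b) as [c2 [Hc2 E2]];
      [lra | intros; apply Hdf; lra | intros; apply Hdg; lra |].
    destruct (mean_value dg ddg a x) as [d1 [Hd1 G1]];
      [lra | intros; apply Hdg; lra |].
    destruct (mean_value dg ddg x b) as [d2 [Hd2 G2]];
      [lra | intros; apply Hdg; lra |].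
    rewrite Fa, Ga, !Rminus_0_r in *.
    assert (P1 : 0 < ddg c1) by (apply Hpos; lra).
    assert (P2 : 0 < ddg c2) by (apply Hpos; lra).
    assert (P3 : 0 < dg x).
    { rewrite G1. apply Rmult_lt_0_compat; [apply Hpos |]; lra. }
    assert (P4 : 0 < dg b - dg x).
    { rewrite G2. apply Rmult_lt_0_compat; [apply Hpos |]; lra. }
    assert (M := Hmon c1 c2 ltac:(lra) ltac:(lra) ltac:(lra)).
    assert (Q1 : 0 < ddg c1 * ddg c2) by (apply Rmult_lt_0_compat; assumption).
    apply Rminus_le_0, (Rmult_le_reg_l _ _ _ Q1). rewrite Rmult_0_r.
    replace (ddg c1 * ddg c2 * (df x * dg b - df b * dg x))
      with ((df x * ddg c1) * ddg c2 * (dg b - dg x)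
            - dg x * ddg c1 * ((df b - df x) * ddg c2)) by ring.
    rewrite E1, E2.
    replace (dg x * ddf c1 * ddg c2 * (dg b - dg x)
             - dg x * ddg c1 * ((dg b - dg x) * ddf c2))
      with (dg x * (dg b - dg x) * (ddf c1 * ddg c2 - ddf c2 * ddg c1)) by ring.
    apply Rmult_le_pos; [apply Rmult_le_pos |]; lra. }
  (* [Hr] makes the derivative of [dg b * f - df b * g] nonnegative, so this function does not
     decrease from [a] to [b]. *)
  destruct (mean_value (fun x => dg b * f x - df b * g x)
              (fun x => dg b * df x - df b * dg x) a b Hab) as [c [Hc E]].
  - intros x Hx.
    apply (is_derive_minus (fun x => dg b * f x) (fun x => df b * g x) x).
    + apply is_derive_scal, Hf, Hx.
    + apply is_derive_scal, Hg, Hx.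
  - assert (M := Hr c Hc).
    assert (0 <= (dg b * df c - df b * dg c) * (b - a))
      by (apply Rmult_le_pos; lra).
    lra.
Qed.

(** * The function 1/(e^x - 1), its derivatives, and its gaps against those of 1/x *)

Lemma exp_gt_1 (x : R) : 0 < x -> 1 < exp x.
Proof. intros Hx. rewrite <- exp_0. apply exp_increasing, Hx. Qed.

Lemma cosh_le (x y : R) : 0 <= x -> x < y -> cosh x <= cosh y.
Proof.
  intros Hx Hxy.
  destruct (mean_value cosh sinh x y Hxy) as [c [Hc E]].
  - intros z _. apply is_derive_Reals, derivable_pt_lim_cosh.
  - assert (0 < sinh c).
    { unfold sinh. assert (exp (- c) < exp c) by (apply exp_increasing; lra). lra. }
    assert (0 < sinh c * (y - x)) by (apply Rmult_lt_0_compat; lra).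
    lra.
Qed.

(** Convexity: chord slopes of [sinh] are values of [cosh], which increases, so the slope over
    [[0, x]] is at most that over [[x, y]]. *)
Lemma sinh_chord_le (x y : R) : 0 < x -> x < y -> y * sinh x <= x * sinh y.
Proof.
  intros Hx Hxy.
  assert (D : forall z, is_derive sinh z (cosh z))
    by (intros z; apply is_derive_Reals, derivable_pt_lim_sinh).
  destruct (mean_value sinh cosh 0 x Hx (fun z _ => D z)) as [c1 [Hc1 E1]].
  destruct (mean_value sinh cosh x y Hxy (fun z _ => D z)) as [c2 [Hc2 E2]].
  rewrite sinh_0 in E1.
  assert (M := cosh_le c1 c2 ltac:(lra) ltac:(lra)).
  assert (0 <= x * (y - x) * (cosh c2 - cosh c1)).
  { apply Rmult_le_pos; [apply Rmult_le_pos |]; lra. }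
  replace (sinh x) with (cosh c1 * x) in * by lra.
  replace (sinh y) with (cosh c1 * x + cosh c2 * (y - x)) by lra.
  lra.
Qed.

(* With [q = exp (- t)], [bose (n * t)] is the Lambert term [q ^ n / (1 - q ^ n)]. *)
Definition bose (x : R) : R := / (exp x - 1).

Definition bose_primitive (x : R) : R := ln (1 - exp (- x)).

Definition bose_slope (x : R) : R := exp x / (exp x - 1) ^ 2.

Lemma bose_pos (x : R) : 0 < x -> 0 < bose x.
Proof.
  intros Hx. apply Rinv_0_lt_compat. generalize (exp_gt_1 x Hx). lra.
Qed.

Lemma bose_lt (x y : R) : 0 < x -> x < y -> bose y < bose x.
Proof.
  intros Hx Hxy. generalize (exp_gt_1 x Hx), (exp_increasing x y Hxy). intros.
  apply Rinv_lt_contravar; [apply Rmult_lt_0_compat |]; lra.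
Qed.

Lemma is_derive_bose_primitive (x : R) :
  0 < x -> is_derive bose_primitive x (bose x).
Proof.
  intros Hx. unfold bose_primitive, bose.
  assert (H := exp_gt_1 x Hx).
  assert (H' : exp (- x) < 1) by (rewrite <- exp_0; apply exp_increasing; lra).
  auto_derive; [lra |].
  rewrite exp_Ropp. field. split; lra.
Qed.

Lemma is_derive_bose (x : R) : 0 < x -> is_derive bose x (- bose_slope x).
Proof.
  intros Hx. unfold bose, bose_slope. generalize (exp_gt_1 x Hx). intros H.
  auto_derive; [lra |]. field. lra.
Qed.

Lemma bose_slope_sinh (x : R) : 0 < x -> bose_slope x = / (2 * sinh (x / 2)) ^ 2.
Proof.
  intros Hx. unfold bose_slope, sinh.
  generalize (exp_gt_1 (x / 2) ltac:(lra)).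
  replace (exp x) with (exp (x / 2) * exp (x / 2))
    by (rewrite <- exp_plus; f_equal; field).
  rewrite exp_Ropp. set (u := exp (x / 2)). intros Hu.
  field. split; nra.
Qed.

(** Cross-multiplied form of the decrease of [x ^ 2 * bose_slope x]. Through [bose_slope_sinh] it
    becomes the inverse square of [sinh_chord_le] at half arguments. *)
Lemma bose_slope_ratio (x y : R) :
  0 < x -> x < y -> bose_slope y * / x ^ 2 <= bose_slope x * / y ^ 2.
Proof.
  intros Hx Hxy. rewrite !bose_slope_sinh by lra.
  assert (S : forall z, 0 < z -> 0 < sinh (z / 2)).
  { intros z Hz. unfold sinh.
    assert (exp (- (z / 2)) < exp (z / 2)) by (apply exp_increasing; lra). lra. }
  assert (Sx := S x Hx). assert (Sy := S y ltac:(lra)).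
  assert (C := sinh_chord_le (x / 2) (y / 2) ltac:(lra) ltac:(lra)).
  rewrite <- !Rinv_mult. rewrite <- !Rpow_mult_distr.
  apply Rinv_le_contravar.
  - apply pow_lt. apply Rmult_lt_0_compat; lra.
  - apply pow_incr. split; [apply Rmult_le_pos |]; lra.
Qed.

(* [bose_primitive] is an antiderivative of [bose], so this compares the gap between
   [bose a * (b - a)] and the integral of [bose] over [a, b] with the same gap for [1 / x]. *)
Lemma bose_gap_comparison (a b : R) :
  0 < a -> a < b ->
  (bose a - bose b) * ((b - a) / a - (ln b - ln a))
  <= (bose a * (b - a) - (bose_primitive b - bose_primitive a)) * (/ a - / b).
Proof.
  intros Ha Hab.
  (* The linear terms make both first derivatives vanish at [a]; the second derivatives are minus
     those of the antiderivatives [bose_primitive] and [ln]. *)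
  assert (L := monotone_lhopital
    (fun x => bose a * x - bose_primitive x) (fun x => / a * x - ln x)
    (fun x => bose a - bose x) (fun x => / a - / x)
    bose_slope (fun x => / x ^ 2) a b Hab). cbv beta in L.
  replace ((b - a) / a - (ln b - ln a))
    with (/ a * b - ln b - (/ a * a - ln a)) by (field; lra).
  replace (bose a * (b - a) - (bose_primitive b - bose_primitive a))
    with (bose a * b - bose_primitive b - (bose a * a - bose_primitive a)) by ring.
  apply L; clear L.
  - intros x Hx. evar_last.
    + apply (is_derive_minus (fun x => bose a * x) bose_primitive x).
      * apply is_derive_scal, (is_derive_id x).
      * apply is_derive_bose_primitive; lra.
    + change (bose a * 1 + - bose x = bose a - bose x). ring.
  - intros x Hx. auto_derive; [lra |]. field. lra.
  - intros x Hx. evar_last.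
    + apply (is_derive_minus (fun _ => bose a) bose x).
      * apply is_derive_const.
      * apply is_derive_bose; lra.
    + change (0 + - - bose_slope x = bose_slope x). ring.
  - intros x Hx. auto_derive; [lra |]. field. lra.
  - lra.
  - lra.
  - intros x Hx. apply Rinv_0_lt_compat, pow_lt. lra.
  - intros x y Hx Hxy _. apply bose_slope_ratio; lra.
Qed.

Lemma bose_primitive_step (a b : R) :
  0 < a -> a < b ->
  bose b * (b - a) < bose_primitive b - bose_primitive a < bose a * (b - a).
Proof.
  intros Ha Hab.
  destruct (mean_value bose_primitive bose a b Hab) as [c [Hc E]].
  - intros x Hx. apply is_derive_bose_primitive. lra.
  - rewrite E. split; apply Rmult_lt_compat_r; try lra; apply bose_lt; lra.
Qed.

(** * The coefficients c_n *)

(** This is c_n at a real argument, so that monotonicity can be read off a derivative: 1/x -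
    ln((x+1)/x) divided by 1/x - 1/(x+1). *)
Definition gap_coef (x : R) : R := x + 1 - x * (x + 1) * (ln (x + 1) - ln x).

(** With v = 1/(2x+1) one has (x+1)/x = (1+v)/(1-v), and ln((1+v)/(1-v)) - 2v vanishes at 0 and has
    derivative 2v^2/(1-v^2) > 0. *)
Lemma ln_step_gt (x : R) : 0 < x -> 2 / (2 * x + 1) < ln (x + 1) - ln x.
Proof.
  intros Hx.
  destruct (mean_value (fun u => ln (1 + u) - ln (1 - u) - 2 * u)
     (fun u => / (1 + u) + / (1 - u) - 2) 0 (/ (2 * x + 1))) as [c [Hc E]].
  - apply Rinv_0_lt_compat; lra.
  - intros u Hu.
    assert (/ (2 * x + 1) < 1).
    { rewrite <- Rinv_1. apply Rinv_lt_contravar; lra. }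
    auto_derive; [lra |]. field. lra.
  - assert (Hv : / (2 * x + 1) < 1).
    { rewrite <- Rinv_1. apply Rinv_lt_contravar; lra. }
    rewrite Rplus_0_r, !Rminus_0_r, ln_1 in E.
    replace (1 + / (2 * x + 1)) with (2 * (x + 1) / (2 * x + 1)) in E by (field; lra).
    replace (1 - / (2 * x + 1)) with (2 * x / (2 * x + 1)) in E by (field; lra).
    rewrite !ln_div, !ln_mult in E by lra.
    assert (0 < (/ (1 + c) + / (1 - c) - 2) * / (2 * x + 1)).
    { apply Rmult_lt_0_compat; [| apply Rinv_0_lt_compat; lra].
      replace (/ (1 + c) + / (1 - c) - 2) with (2 * c ^ 2 / (1 - c ^ 2)) by (field; nra).
      apply Rdiv_lt_0_compat; nra. }
    unfold Rdiv. lra.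
Qed.

Lemma gap_coef_lt (x y : R) : 0 < x -> x < y -> gap_coef y < gap_coef x.
Proof.
  intros Hx Hxy.
  destruct (mean_value gap_coef (fun z => 2 - (2 * z + 1) * (ln (z + 1) - ln z)) x y Hxy)
    as [c [Hc E]].
  - intros z Hz. unfold gap_coef. auto_derive; [lra |]. field. lra.
  - assert (L := ln_step_gt c ltac:(lra)).
    assert (2 < (2 * c + 1) * (ln (c + 1) - ln c)).
    { apply (Rmult_lt_compat_l (2 * c + 1)) in L; [| lra].
      replace ((2 * c + 1) * (2 / (2 * c + 1))) with 2 in L by (field; lra). exact L. }
    assert (0 < ((2 * c + 1) * (ln (c + 1) - ln c) - 2) * (y - x))
      by (apply Rmult_lt_0_compat; lra).
    lra.
Qed.

Lemma gap_coef_pos (x : R) : 0 < x -> 0 <= gap_coef x.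
Proof.
  intros Hx. unfold gap_coef. assert (L := ln_step_upper x Hx).
  apply (Rmult_le_compat_l (x * (x + 1))) in L; [| nra].
  replace (x * (x + 1) * / x) with (x + 1) in L by (field; lra). lra.
Qed.

(** * Divisor sums and the Lambert series *)

Lemma sum_n_m_1_S (a : nat -> R) (N : nat) :
  sum_n_m a 1 (S N) = sum_n_m a 1 N + a (S N).
Proof. apply (sum_n_Sm a 1 N). lia. Qed.

Lemma sum_n_m_1_0 (a : nat -> R) : sum_n_m a 1 0 = 0.
Proof. apply (sum_n_m_zero a 1 0). lia. Qed.

(** Any [N >= j] may bound the range, so the range does not depend on [j] and the double sum can be
    switched. *)
Lemma num_divisors_sum (j N : nat) :
  (1 <= j <= N)%nat ->
  INR (num_divisors j) = sum_n_m (fun m => INR (ssrnat.nat_of_bool (div.dvdn m j))) 1 N.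
Proof.
  intros [Hj HN].
  assert (E : num_divisors j = seq.count (fun m => div.dvdn m j) (seq.iota 1 N)).
  { unfold num_divisors. rewrite <- seq.size_filter. apply seq.perm_size, seq.uniq_perm.
    - apply prime.divisors_uniq.
    - apply seq.filter_uniq, seq.iota_uniq.
    - intros m. rewrite <- prime.dvdn_divisors by (apply (ssrbool.introT ssrnat.leP); lia).
      rewrite seq.mem_filter, seq.mem_iota.
      destruct (div.dvdn m j) eqn:D; [| reflexivity]. symmetry. simpl.
      assert (Hm : (m <= j)%nat).
      { apply (ssrbool.elimT ssrnat.leP), div.dvdn_leq; [| exact D].
        apply (ssrbool.introT ssrnat.leP); lia. }
      assert (Hm0 : (1 <= m)%nat).
      { apply (ssrbool.elimT ssrnat.leP). refine (div.dvdn_gt0 _ D).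
        apply (ssrbool.introT ssrnat.leP); lia. }
      apply andb_true_intro. split; apply (ssrbool.introT ssrnat.leP).
      + exact Hm0.
      + unfold ssrnat.addn. simpl. lia. }
  rewrite E. clear E Hj HN. induction N as [| N IH].
  - now rewrite sum_n_m_1_0.
  - rewrite sum_n_m_1_S, <- IH, <- plus_INR. f_equal.
    replace (S N) with (ssrnat.addn N 1) at 1 by (rewrite ssrnat.addn1; reflexivity).
    rewrite seq.iotaD, seq.count_cat. simpl. rewrite ssrnat.addn0. reflexivity.
Qed.

Lemma num_divisors_ge_1 (j : nat) : (1 <= j)%nat -> 1 <= INR (num_divisors j).
Proof.
  intros Hj. unfold num_divisors.
  assert (H := prime.dvdn_divisors 1 (ssrbool.introT ssrnat.leP Hj)).
  rewrite div.dvd1n in H.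
  destruct (prime.divisors j) as [| d s]; [discriminate H |].
  simpl seq.size. rewrite S_INR. generalize (pos_INR (seq.size s)). lra.
Qed.

Lemma sum_n_m_1_switch (u : nat -> nat -> R) (M N : nat) :
  sum_n_m (fun i => sum_n_m (u i) 1 N) 1 M = sum_n_m (fun j => sum_n_m (fun i => u i j) 1 M) 1 N.
Proof.
  induction M as [| M IH].
  - rewrite sum_n_m_1_0. symmetry. rewrite (sum_n_m_ext _ (fun _ => 0)).
    + apply (sum_n_m_const_zero (G := R_AbelianMonoid)).
    + intros n. apply sum_n_m_1_0.
  - rewrite sum_n_m_1_S, IH.
    rewrite (sum_n_m_ext (fun j => sum_n_m (fun i => u i j) 1 (S M))
       (fun j => plus (sum_n_m (fun i => u i j) 1 M) (u (S M) j)))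
      by (intros; apply sum_n_m_1_S).
    now rewrite sum_n_m_plus.
Qed.

(** The surviving exponents are the multiples of [m] up to [N], a geometric progression of ratio
    [q ^ m] whose first omitted exponent is [m * S (div.divn N m)]. *)
Lemma multiples_geometric_sum (q : R) (m N : nat) :
  (1 <= m)%nat ->
  sum_n_m (fun j => INR (ssrnat.nat_of_bool (div.dvdn m j)) * q ^ j) 1 N * (1 - q ^ m)
  = q ^ m - q ^ (m * S (div.divn N m)).
Proof.
  intros Hm. assert (Hm' : is_true (ssrnat.leq 1 m))
    by (apply (ssrbool.introT ssrnat.leP); lia).
  induction N as [| N IH].
  - rewrite sum_n_m_1_0, div.div0n, Nat.mul_1_r. ring.
  - rewrite sum_n_m_1_S, Rmult_plus_distr_r, IH, (div.divnS N Hm').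
    destruct (div.dvdn m (S N)) eqn:D; simpl ssrnat.nat_of_bool.
    + assert (E := div.divnK D). rewrite (div.divnS N Hm'), D in E.
      unfold ssrnat.muln, ssrnat.addn in *. simpl Nat.add in *.
      replace (S N) with (m * S (div.divn N m))%nat by (simpl in E; lia).
      replace (m * S (S (div.divn N m)))%nat
        with (m + m * S (div.divn N m))%nat by lia.
      rewrite pow_add. simpl INR. ring.
    + unfold ssrnat.addn. simpl. ring.
Qed.

Lemma lt_mul_S_div (m N : nat) : (1 <= m)%nat -> (S N <= m * S (div.divn N m))%nat.
Proof.
  intros Hm. rewrite Nat.mul_comm.
  apply (ssrbool.elimT ssrnat.leP), (div.ltn_ceil N).
  apply (ssrbool.introT ssrnat.leP); lia.
Qed.

Definition lambert (q : R) (N : nat) : R := sum_n_m (fun m => q ^ m / (1 - q ^ m)) 1 N.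

Definition divisor_sum (q : R) (N : nat) : R :=
  sum_n_m (fun j => INR (num_divisors j) * q ^ j) 1 N.

Lemma sum_n_m_1_le (a b : nat -> R) (N : nat) :
  (forall k, (1 <= k <= N)%nat -> a k <= b k) -> sum_n_m a 1 N <= sum_n_m b 1 N.
Proof.
  induction N as [| N IH]; intros H.
  - rewrite !sum_n_m_1_0. lra.
  - rewrite !sum_n_m_1_S. apply Rplus_le_compat; [apply IH; intros; apply H; lia |].
    apply H. lia.
Qed.

Lemma divisor_sum_swap (q : R) (N : nat) :
  divisor_sum q N
  = sum_n_m (fun m =>
      sum_n_m (fun j => INR (ssrnat.nat_of_bool (div.dvdn m j)) * q ^ j) 1 N) 1 N.
Proof.
  rewrite sum_n_m_1_switch. unfold divisor_sum.
  apply sum_n_m_ext_loc. intros j Hj.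
  rewrite (num_divisors_sum j N Hj).
  symmetry. apply (sum_n_m_mult_r (K := R_Ring) (q ^ j)
    (fun m => INR (ssrnat.nat_of_bool (div.dvdn m j)))).
Qed.

Lemma pow_lt_1 (q : R) (m : nat) : 0 < q < 1 -> (1 <= m)%nat -> 0 < q ^ m <= q.
Proof.
  intros Hq Hm. split; [apply pow_lt; lra |].
  destruct m as [| m]; [lia |]. simpl.
  assert (q ^ m <= 1) by (rewrite <- (pow1 m); apply pow_incr; lra). nra.
Qed.

(** Each Lambert term is the full geometric series over the multiples of [m]. Cutting it at [N]
    loses a tail that is positive and at most [q ^ S N / (1 - q)], and there are [N] such tails. *)
Lemma lambert_divisor_sum (q : R) (N : nat) :
  0 < q < 1 ->
  divisor_sum q N <= lambert q N <= divisor_sum q N + INR N * q ^ S N / (1 - q).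
Proof.
  intros Hq. rewrite divisor_sum_swap. unfold lambert.
  assert (E : forall m, (1 <= m)%nat ->
    q ^ m / (1 - q ^ m)
    = sum_n_m (fun j => INR (ssrnat.nat_of_bool (div.dvdn m j)) * q ^ j) 1 N
      + q ^ (m * S (div.divn N m)) / (1 - q ^ m)).
  { intros m Hm. assert (B := pow_lt_1 q m Hq Hm).
    assert (G := multiples_geometric_sum q m N Hm).
    apply (Rmult_eq_reg_r (1 - q ^ m)); [| lra].
    rewrite Rmult_plus_distr_r, G. field. lra. }
  split.
  - apply sum_n_m_1_le. intros m [Hm _]. rewrite (E m Hm).
    assert (B := pow_lt_1 q m Hq Hm).
    assert (0 < q ^ (m * S (div.divn N m)) / (1 - q ^ m)); [| lra].
    apply Rdiv_lt_0_compat; [apply pow_lt |]; lra.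
  - assert (C : INR N * q ^ S N / (1 - q) = sum_n_m (fun _ => q ^ S N / (1 - q)) 1 N).
    { rewrite (sum_n_m_const 1 N). replace (S N - 1)%nat with N by lia.
      apply Rmult_assoc. }
    rewrite C.
    change (sum_n_m (fun m => q ^ m / (1 - q ^ m)) 1 N
      <= plus (sum_n_m (fun m => sum_n_m
          (fun j => INR (ssrnat.nat_of_bool (div.dvdn m j)) * q ^ j) 1 N) 1 N)
         (sum_n_m (fun _ => q ^ S N / (1 - q)) 1 N)).
    rewrite <- sum_n_m_plus. apply sum_n_m_1_le. intros m [Hm _].
    rewrite (E m Hm). apply Rplus_le_compat_l.
    assert (B := pow_lt_1 q m Hq Hm).
    apply Rmult_le_compat.
    + apply pow_le; lra.
    + apply Rlt_le, Rinv_0_lt_compat; lra.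
    + replace (m * S (div.divn N m))%nat
        with (S N + (m * S (div.divn N m) - S N))%nat
        by (generalize (lt_mul_S_div m N Hm); lia).
      rewrite pow_add. rewrite <- (Rmult_1_r (q ^ S N)) at 2.
      apply Rmult_le_compat_l; [apply pow_le; lra |].
      rewrite <- (pow1 (m * S (div.divn N m) - S N)). apply pow_incr; lra.
    + apply Rinv_le_contravar; lra.
Qed.

Lemma lambert_le (q : R) (N : nat) : 0 < q < 1 -> lambert q N <= q / (1 - q) ^ 2.
Proof.
  intros Hq.
  assert (H : lambert q N <= (q - q ^ S N) / (1 - q) ^ 2).
  { unfold lambert. induction N as [| N IH].
    - rewrite sum_n_m_1_0. simpl. right.
      replace (q - q * 1) with 0 by ring. symmetry. apply Rmult_0_l.
    - rewrite sum_n_m_1_S.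
      replace ((q - q ^ S (S N)) / (1 - q) ^ 2)
        with ((q - q ^ S N) / (1 - q) ^ 2 + q ^ S N / (1 - q))
        by (simpl; field; lra).
      apply Rplus_le_compat; [exact IH |].
      assert (B := pow_lt_1 q (S N) Hq ltac:(lia)).
      apply Rmult_le_compat_l; [lra |]. apply Rinv_le_contravar; lra. }
  apply (Rle_trans _ _ _ H). apply Rmult_le_compat_r.
  - apply Rlt_le, Rinv_0_lt_compat, pow_lt. lra.
  - assert (0 < q ^ S N) by (apply pow_lt; lra). lra.
Qed.

(** * The series of the theorem and its relation to the Lambert series *)

Definition divisor_count (n : nat) : R := sum_n_m (fun j => INR (num_divisors j)) 1 n.

Lemma divisor_count_ge (n : nat) : INR n <= divisor_count n.
Proof.
  unfold divisor_count. induction n as [| n IH].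
  - rewrite sum_n_m_1_0. apply Rle_refl.
  - rewrite sum_n_m_1_S, S_INR.
    generalize (num_divisors_ge_1 (S n) ltac:(lia)). lra.
Qed.

(** Summation by parts: the factor [1 - q] turns summatory values into single divisor numbers, up to
    a boundary term. *)
Lemma divisor_count_series_partial (q : R) (N : nat) :
  (1 - q) * sum_n (fun n => divisor_count (S n) * q ^ S n) N
  = divisor_sum q (S N) - divisor_count (S N) * q ^ S (S N).
Proof.
  unfold divisor_sum, divisor_count. induction N as [| N IH].
  - rewrite sum_O, !sum_n_m_1_S, !sum_n_m_1_0. simpl. ring.
  - rewrite sum_Sn. change plus with Rplus.
    rewrite Rmult_plus_distr_l, IH, !(sum_n_m_1_S _ (S N)). simpl. ring.
Qed.

Lemma ex_series_divisor_count (q : R) :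
  0 < q < 1 -> ex_series (fun n => divisor_count (S n) * q ^ S n).
Proof.
  intros Hq.
  destruct (ex_finite_lim_seq_incr (sum_n (fun n => divisor_count (S n) * q ^ S n))
     (q / (1 - q) ^ 3)) as [l Hl].
  - intros n. rewrite sum_Sn. change plus with Rplus.
    assert (0 <= divisor_count (S (S n)) * q ^ S (S n)); [| lra].
    apply Rmult_le_pos; [| apply pow_le; lra].
    apply (Rle_trans _ (INR (S (S n)))); [apply pos_INR | apply divisor_count_ge].
  - intros N. apply (Rmult_le_reg_l (1 - q)); [lra |].
    rewrite divisor_count_series_partial.
    replace ((1 - q) * (q / (1 - q) ^ 3)) with (q / (1 - q) ^ 2) by (field; lra).
    assert (A := lambert_le q (S N) Hq). assert (B := lambert_divisor_sum q (S N) Hq).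
    assert (0 <= divisor_count (S N) * q ^ S (S N)); [| lra].
    apply Rmult_le_pos; [| apply pow_le; lra].
    apply (Rle_trans _ (INR (S N))); [apply pos_INR | apply divisor_count_ge].
  - exists l. exact Hl.
Qed.

(** A squeeze by [lambert_divisor_sum]. Both the boundary term and, via [divisor_count_ge], the
    truncation error are bounded by multiples of the general term of the convergent series. *)
Lemma is_lim_seq_lambert (q : R) :
  0 < q < 1 ->
  is_lim_seq (lambert q) ((1 - q) * Series (fun n => divisor_count (S n) * q ^ S n)).
Proof.
  intros Hq. assert (Hex := ex_series_divisor_count q Hq).
  set (T := Series _).
  assert (HT : is_lim_seq (sum_n (fun n => divisor_count (S n) * q ^ S n)) T)
    by apply (Series_correct _ Hex).
  assert (Z : is_lim_seq (fun n => divisor_count (S n) * q ^ S n) 0)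
    by (apply ex_series_lim_0, Hex).
  apply is_lim_seq_incr_1.
  assert (U : is_lim_seq (fun N => divisor_sum q (S N)) ((1 - q) * T)).
  { apply (is_lim_seq_ext (fun N =>
      (1 - q) * sum_n (fun n => divisor_count (S n) * q ^ S n) N
      + q * (divisor_count (S N) * q ^ S N))).
    - intros N. rewrite divisor_count_series_partial. simpl. ring.
    - replace ((1 - q) * T) with ((1 - q) * T + q * 0) by ring.
      apply is_lim_seq_plus'.
      + apply (is_lim_seq_scal_l _ (1 - q) T HT).
      + apply (is_lim_seq_scal_l _ q 0 Z). }
  apply (is_lim_seq_le_le (fun N => divisor_sum q (S N)) _
    (fun N => divisor_sum q (S N) + q / (1 - q) * (divisor_count (S N) * q ^ S N))).
  - intros N. assert (B := lambert_divisor_sum q (S N) Hq). split; [lra |].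
    apply (Rle_trans _ _ _ (proj2 B)), Rplus_le_compat_l.
    replace (INR (S N) * q ^ S (S N) / (1 - q))
      with (q / (1 - q) * (INR (S N) * q ^ S N)) by (simpl pow; field; lra).
    apply Rmult_le_compat_l; [apply Rlt_le, Rdiv_lt_0_compat; lra |].
    apply Rmult_le_compat_r; [apply pow_le; lra | apply divisor_count_ge].
  - exact U.
  - replace ((1 - q) * T) with ((1 - q) * T + q / (1 - q) * 0) by ring.
    apply is_lim_seq_plus'; [exact U |].
    apply (is_lim_seq_scal_l _ (q / (1 - q)) 0 Z).
Qed.

(** * The gaps D_n and their partial sums *)

Lemma exp_INR_mult (n : nat) (x : R) : exp (INR n * x) = exp x ^ n.
Proof.
  induction n as [| n IH].
  - simpl. now rewrite Rmult_0_l, exp_0.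
  - rewrite S_INR, Rmult_plus_distr_r, Rmult_1_l, exp_plus, IH. simpl. ring.
Qed.

(** Bernoulli's inequality ([poly]) for the n-th power of e^t = 1 + (e^t - 1). *)
Lemma bose_mult_le (t : R) (n : nat) :
  0 < t -> (1 <= n)%nat -> bose (INR n * t) <= bose t * / INR n.
Proof.
  intros Ht Hn. assert (Hn' : 1 <= INR n) by (apply (le_INR 1), Hn).
  assert (HQ := exp_gt_1 t Ht).
  unfold bose. rewrite <- Rinv_mult. apply Rinv_le_contravar.
  { apply Rmult_lt_0_compat; lra. }
  assert (B := poly n (exp t - 1)).
  replace (1 + (exp t - 1)) with (exp t) in B by ring.
  rewrite <- exp_INR_mult in B. specialize (B ltac:(lra)). lra.
Qed.

(** The source of strictness in [excess_gt]: e^(2t) - 1 exceeds 2(e^t - 1) by (e^t - 1)^2. *)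
Lemma bose_double_lt (t : R) : 0 < t -> bose (INR 2 * t) < bose t * / 2.
Proof.
  intros Ht. assert (HQ := exp_gt_1 t Ht).
  unfold bose. rewrite <- Rinv_mult.
  replace (INR 2 * t) with (t + t) by (simpl; ring). rewrite exp_plus.
  assert (0 < (exp t - 1) * (exp t - 1)) by (apply Rmult_lt_0_compat; lra).
  apply Rinv_lt_contravar; [apply Rmult_lt_0_compat |]; lra.
Qed.

Lemma bose_primitive_bose (x : R) : 0 < x -> bose_primitive x = - ln (bose x) - x.
Proof.
  intros Hx. assert (H := exp_gt_1 x Hx). unfold bose_primitive, bose.
  rewrite ln_Rinv by lra.
  replace (1 - exp (- x)) with ((exp x - 1) / exp x)
    by (rewrite exp_Ropp; field; lra).
  rewrite ln_div, ln_exp by lra. ring.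
Qed.

(* The integral of [bose (x * t)] over [n, n + 1] is written with the antiderivative. *)
Definition bose_gap (t : R) (n : nat) : R :=
  bose (INR n * t) - (bose_primitive (INR (S n) * t) - bose_primitive (INR n * t)) / t.

Lemma bose_gap_bounds (t : R) (n : nat) :
  0 < t -> (1 <= n)%nat ->
  0 < bose_gap t n < bose (INR n * t) - bose (INR (S n) * t).
Proof.
  intros Ht Hn. assert (Hn' : 1 <= INR n) by (apply (le_INR 1), Hn).
  unfold bose_gap.
  destruct (bose_primitive_step (INR n * t) (INR (S n) * t)) as [H1 H2];
    [nra | rewrite S_INR; nra |].
  replace (INR (S n) * t - INR n * t) with t in * by (rewrite S_INR; ring).
  set (d := _ - bose_primitive (INR n * t)) in *.
  assert (Hd : d = d / t * t) by (field; lra).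
  rewrite Hd in H1, H2.
  apply Rmult_lt_reg_r in H1; [| exact Ht]. apply Rmult_lt_reg_r in H2; [| exact Ht].
  lra.
Qed.

(** [bose_gap_comparison] on [nt, (n+1)t], multiplied by n(n+1); the scale [t] cancels. *)
Lemma bose_gap_ge (t : R) (n : nat) :
  0 < t -> (1 <= n)%nat ->
  gap_coef (INR n) * (bose (INR n * t) - bose (INR (S n) * t)) <= bose_gap t n.
Proof.
  intros Ht Hn. assert (Hn' : 1 <= INR n) by (apply (le_INR 1), Hn).
  assert (C := bose_gap_comparison (INR n * t) (INR (S n) * t)
    ltac:(nra) ltac:(rewrite S_INR; nra)).
  unfold bose_gap, gap_coef. rewrite !S_INR in *.
  rewrite !ln_mult in C by lra.
  set (x := INR n) in *. set (u := bose (x * t)) in *.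
  set (v := bose ((x + 1) * t)) in *.
  set (d := _ - bose_primitive (x * t)) in *.
  assert (P : 0 < x * (x + 1)) by nra.
  apply (Rmult_le_compat_l _ _ _ (Rlt_le _ _ P)) in C.
  replace (x * (x + 1) *
    ((u * ((x + 1) * t - x * t) - d) * (/ (x * t) - / ((x + 1) * t))))
    with (u - d / t) in C by (field; lra).
  refine (Rle_trans _ _ _ (Req_le _ _ _) C). field. nra.
Qed.

Lemma sum_bose_gap (t : R) (N : nat) :
  sum_n_m (bose_gap t) 1 N
  = sum_n_m (fun n => bose (INR n * t)) 1 N
    - (bose_primitive (INR (S N) * t) - bose_primitive t) / t.
Proof.
  induction N as [| N IH].
  - rewrite !sum_n_m_1_0. simpl INR. rewrite Rmult_1_l.
    apply Rminus_diag_uniq. unfold Rdiv. ring.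
  - rewrite !sum_n_m_1_S, IH.
    apply Rminus_diag_uniq. unfold bose_gap, Rdiv. ring.
Qed.

Lemma sum_bose_gap_tail (t : R) (M N : nat) :
  0 < t -> (M <= N)%nat ->
  sum_n_m (bose_gap t) 1 M <= sum_n_m (bose_gap t) 1 N
  <= sum_n_m (bose_gap t) 1 M + bose (INR (S M) * t).
Proof.
  intros Ht HMN.
  (* The subtracted last term is what the telescoping bound leaves, and it carries the induction. *)
  assert (H : sum_n_m (bose_gap t) 1 M <= sum_n_m (bose_gap t) 1 N
    <= sum_n_m (bose_gap t) 1 M + bose (INR (S M) * t) - bose (INR (S N) * t)).
  { induction HMN as [| N HMN IH]; [lra |].
    rewrite sum_n_m_1_S.
    assert (B := bose_gap_bounds t (S N) Ht ltac:(lia)). lra. }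
  assert (0 < bose (INR (S N) * t)); [| lra].
  apply bose_pos, Rmult_lt_0_compat; [apply lt_0_INR; lia | exact Ht].
Qed.

Lemma euler_gap_gap_coef (x : R) :
  0 < x -> / x - (ln (x + 1) - ln x) = gap_coef x * (/ x - / (x + 1)).
Proof. intros Hx. unfold gap_coef. field. lra. Qed.

(* Abel summation; the middle term is kept to make the final inequality strict. *)
Lemma sum_bose_gap_ge (t : R) (N : nat) :
  0 < t ->
  bose t * (harmonic (S (S N)) - ln (INR (S (S (S N)))))
  + (gap_coef 1 - gap_coef 2) * (bose t * / 2 - bose (INR 2 * t))
  + gap_coef (INR (S (S N)))
    * (bose t * / INR (S (S (S N))) - bose (INR (S (S (S N))) * t))
  <= sum_n_m (bose_gap t) 1 (S (S N)).
Proof.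
  intros Ht. induction N as [| N IH].
  - unfold harmonic. rewrite !sum_n_m_1_S, !sum_n_m_1_0.
    assert (G1 := bose_gap_ge t 1 Ht ltac:(lia)).
    assert (G2 := bose_gap_ge t 2 Ht ltac:(lia)).
    assert (E1 := euler_gap_gap_coef 1 ltac:(lra)).
    assert (E2 := euler_gap_gap_coef 2 ltac:(lra)).
    change (INR 1) with 1 in *. change (INR 2) with 2 in *.
    replace (INR 3) with (2 + 1) in * by (simpl; ring).
    replace (1 + 1) with 2 in E1 by ring.
    rewrite Rmult_1_l, ln_1 in *.
    apply (f_equal (Rmult (bose t))) in E1. apply (f_equal (Rmult (bose t))) in E2.
    lra.
  - rewrite harmonic_S, sum_n_m_1_S.
    set (n := S (S N)) in *.
    assert (Hn : 0 < INR n) by (apply lt_0_INR; unfold n; lia).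
    assert (G := bose_gap_ge t (S n) Ht ltac:(lia)).
    assert (E := euler_gap_gap_coef (INR (S n)) ltac:(apply lt_0_INR; lia)).
    rewrite <- (S_INR (S n)) in E. apply (f_equal (Rmult (bose t))) in E.
    assert (D := gap_coef_lt (INR n) (INR (S n)) Hn ltac:(rewrite S_INR; lra)).
    assert (B := bose_mult_le t (S n) Ht ltac:(lia)).
    (* This is the new Abel term: c_n decreases, and its weight f(t)/(n+1) - f((n+1)t) is
       nonnegative. *)
    assert (0 <= (gap_coef (INR n) - gap_coef (INR (S n)))
              * (bose t * / INR (S n) - bose (INR (S n) * t)))
      by (apply Rmult_le_pos; lra).
    lra.
Qed.

(** * Passage to the limit and the two strict bounds *)

(** With [S N] in the logarithm these are exactly the partial sums of the E_n. *)
Lemma euler_gamma_lim_shift :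
  is_lim_seq (fun N => harmonic N - ln (INR (S N))) euler_gamma.
Proof.
  apply (is_lim_seq_ext (fun N => harmonic (S N) - ln (INR (S N)) - / INR (S N))).
  - intros N. rewrite harmonic_S. ring.
  - replace euler_gamma with (euler_gamma - 0) by ring.
    apply is_lim_seq_minus'.
    + apply (is_lim_seq_incr_1 (fun N => harmonic N - ln (INR N))), euler_gamma_is_lim.
    + apply (is_lim_seq_incr_1 (fun N => / INR N)).
      apply (is_lim_seq_inv INR p_infty); [apply is_lim_seq_INR | discriminate].
Qed.

(* [(1 - q) * S - ln (1 - q) / ln q] for [q = exp (- t)], where [S] is the series of the
   theorem. *)
Definition excess (t : R) : R :=
  (1 - exp (- t)) * Series (fun n => divisor_count (S n) * exp (- t) ^ S n)
  + bose_primitive t / t.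

Lemma exp_neg_lt_1 (t : R) : 0 < t -> 0 < exp (- t) < 1.
Proof.
  intros Ht. split; [apply exp_pos |]. rewrite <- exp_0. apply exp_increasing. lra.
Qed.

(** The antiderivatives telescope, leaving a Lambert partial sum, a constant, and ln(1 - q^(N+1))/t,
    which tends to 0. *)
Lemma is_lim_seq_sum_bose_gap (t : R) :
  0 < t -> is_lim_seq (sum_n_m (bose_gap t) 1) (excess t).
Proof.
  intros Ht. assert (Hq := exp_neg_lt_1 t Ht).
  apply (is_lim_seq_ext (fun N =>
    lambert (exp (- t)) N + (bose_primitive t / t - ln (1 - exp (- t) ^ S N) / t))).
  - intros N. rewrite sum_bose_gap. unfold bose_primitive at 2.
    replace (exp (- (INR (S N) * t))) with (exp (- t) ^ S N)
      by (rewrite <- exp_INR_mult; f_equal; ring).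
    unfold lambert.
    rewrite (sum_n_m_ext_loc (fun m => exp (- t) ^ m / (1 - exp (- t) ^ m))
       (fun n => bose (INR n * t))).
    + apply Rminus_diag_uniq. unfold Rdiv. ring.
    + intros m [Hm _]. assert (1 <= INR m) by (apply (le_INR 1), Hm).
      assert (HQ := exp_gt_1 (INR m * t) ltac:(nra)).
      rewrite <- exp_INR_mult. replace (INR m * - t) with (- (INR m * t)) by ring.
      unfold bose. rewrite exp_Ropp. apply Rminus_diag_uniq. field. lra.
  - unfold excess.
    replace (bose_primitive t / t) with (bose_primitive t / t - ln (1 - 0) * / t) at 1
      by (rewrite Rminus_0_r, ln_1; ring).
    apply is_lim_seq_plus'; [apply is_lim_seq_lambert, Hq |].
    apply is_lim_seq_minus'; [apply is_lim_seq_const |].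
    apply (is_lim_seq_scal_r _ (/ t) (ln (1 - 0))).
    apply (is_lim_seq_continuous ln).
    + apply derivable_continuous_pt. exists (/ (1 - 0)). apply derivable_pt_lim_ln. lra.
    + apply is_lim_seq_minus'; [apply is_lim_seq_const |].
      apply (is_lim_seq_incr_1 (fun n => exp (- t) ^ n)), is_lim_seq_geom.
      rewrite Rabs_pos_eq; lra.
Qed.

Lemma excess_bounds (t : R) (M : nat) :
  0 < t ->
  sum_n_m (bose_gap t) 1 M <= excess t
  <= sum_n_m (bose_gap t) 1 M + bose (INR (S M) * t).
Proof.
  intros Ht.
  assert (L : is_lim_seq (fun N => sum_n_m (bose_gap t) 1 (N + M)) (excess t))
    by (apply (is_lim_seq_incr_n (sum_n_m (bose_gap t) 1)), is_lim_seq_sum_bose_gap, Ht).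
  assert (B := fun N => sum_bose_gap_tail t M (N + M) Ht ltac:(lia)).
  split.
  - apply (is_lim_seq_le _ _ _ (excess t) (fun N => proj1 (B N))
             (is_lim_seq_const (sum_n_m (bose_gap t) 1 M)) L).
  - apply (is_lim_seq_le _ _ (excess t) _ (fun N => proj2 (B N)) L
             (is_lim_seq_const (sum_n_m (bose_gap t) 1 M + bose (INR (S M) * t)))).
Qed.

(** Splitting off one gap keeps the inequality strict: D_1 < f(t) - f(2t), while the remaining gaps
    add up to at most f(2t). *)
Lemma excess_lt (t : R) : 0 < t -> excess t < bose t.
Proof.
  intros Ht. assert (E := excess_bounds t 1 Ht).
  rewrite sum_n_m_1_S, sum_n_m_1_0 in E.
  assert (B := bose_gap_bounds t 1 Ht ltac:(lia)).
  change (INR 1) with 1 in B. rewrite Rmult_1_l in B. lra.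
Qed.

Lemma excess_gt (t : R) : 0 < t -> euler_gamma * bose t < excess t.
Proof.
  intros Ht.
  (* A positive surplus independent of [N], so strictness survives the limit. *)
  set (d := (gap_coef 1 - gap_coef 2) * (bose t * / 2 - bose (INR 2 * t))).
  assert (Hd : 0 < d).
  { apply Rmult_lt_0_compat.
    - generalize (gap_coef_lt 1 2 ltac:(lra) ltac:(lra)). lra.
    - generalize (bose_double_lt t Ht). lra. }
  apply (Rlt_le_trans _ (bose t * euler_gamma + d)); [lra |].
  apply (is_lim_seq_le
    (fun N => bose t * (harmonic (S (S N)) - ln (INR (S (S (S N))))) + d)
    (fun N => sum_n_m (bose_gap t) 1 (S (S N)))
    (bose t * euler_gamma + d) (excess t)).
  - intros N. assert (G := sum_bose_gap_ge t N Ht). fold d in G.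
    assert (0 <= gap_coef (INR (S (S N)))
      * (bose t * / INR (S (S (S N))) - bose (INR (S (S (S N))) * t))); [| lra].
    apply Rmult_le_pos.
    + apply gap_coef_pos, lt_0_INR. lia.
    + generalize (bose_mult_le t (S (S (S N))) Ht ltac:(lia)). lra.
  - apply is_lim_seq_plus'; [| apply is_lim_seq_const].
    apply (is_lim_seq_scal_l _ (bose t) euler_gamma).
    apply (is_lim_seq_incr_1 (fun N => harmonic (S N) - ln (INR (S (S N))))).
    apply (is_lim_seq_incr_1 (fun N => harmonic N - ln (INR (S N)))).
    apply euler_gamma_lim_shift.
  - apply (is_lim_seq_incr_1 (fun N => sum_n_m (bose_gap t) 1 (S N))).
    apply (is_lim_seq_incr_1 (sum_n_m (bose_gap t) 1)).
    apply is_lim_seq_sum_bose_gap, Ht.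
Qed.

(** * Behaviour of the excess for small and for large t *)

(** Keeps [M] gaps and bounds each f(nt), and the tail f((M+1)t), by [bose_mult_le]. Letting t tend
    to 0 and then M to infinity leaves gamma. *)
Lemma excess_near_0 (t : R) (M : nat) :
  0 < t ->
  excess t <= bose t * (harmonic M - ln (INR (S M)) + / INR (S M) + INR M * t).
Proof.
  intros Ht. apply (Rle_trans _ _ _ (proj2 (excess_bounds t M Ht))).
  rewrite sum_bose_gap.
  assert (HS : 0 < INR (S M)) by (apply lt_0_INR; lia).
  assert (Hb := bose_pos t Ht).
  assert (HSt : 0 < bose (INR (S M) * t)) by (apply bose_pos; nra).
  assert (B := bose_mult_le t (S M) Ht ltac:(lia)).
  assert (H1 : sum_n_m (fun n => bose (INR n * t)) 1 M <= bose t * harmonic M).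
  { unfold harmonic.
    apply (Rle_trans _ (sum_n_m (fun n => bose t * / INR n) 1 M)).
    - apply sum_n_m_1_le. intros n [Hn _]. apply bose_mult_le; assumption.
    - apply Req_le, (sum_n_m_mult_l (K := R_Ring) (bose t) (fun n => / INR n)). }
  assert (H2 : ln (INR (S M)) - INR M * t
    <= bose_primitive (INR (S M) * t) - bose_primitive t).
  { rewrite !bose_primitive_bose by nra.
    assert (L : ln (bose (INR (S M) * t)) <= ln (bose t * / INR (S M)))
      by (apply ln_le; assumption).
    rewrite ln_mult, ln_Rinv in L by auto using Rinv_0_lt_compat.
    rewrite S_INR in *. lra. }
  assert (H3 : 0 <= bose_primitive (INR (S M) * t) - bose_primitive t).
  { destruct M as [| M].
    - change (INR 1) with 1. rewrite Rmult_1_l. lra.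
    - assert (0 <= INR M) by apply pos_INR.
      assert (St := bose_primitive_step t (INR (S (S M)) * t) Ht
        ltac:(rewrite !S_INR; nra)).
      assert (0 < bose (INR (S (S M)) * t) * (INR (S (S M)) * t - t)); [| lra].
      apply Rmult_lt_0_compat; [assumption | rewrite !S_INR; nra]. }
  assert (H4 : bose t <= / t).
  { apply Rinv_le_contravar; [exact Ht |]. generalize (exp_ineq1_le t). lra. }
  set (d := _ - bose_primitive t) in *.
  (* Since [d >= 0] and [bose t <= / t], the factor [/ t] may be lowered to [bose t], the common
     factor of the bound. *)
  assert (bose t * (ln (INR (S M)) - INR M * t) <= d / t); [| lra].
  apply (Rle_trans _ (bose t * d)).
  - apply Rmult_le_compat_l; lra.
  - rewrite Rmult_comm. apply Rmult_le_compat_l; assumption.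
Qed.

(** The first gap alone suffices: its integral is at most [- bose_primitive t / t], and -ln(1 -
    e^(-t)) = ln(1 + f(t)) <= f(t). *)
Lemma excess_near_infinity (t : R) : 0 < t -> bose t * (1 - / t) <= excess t.
Proof.
  intros Ht. assert (E := proj1 (excess_bounds t 1 Ht)).
  refine (Rle_trans _ _ _ _ E).
  rewrite sum_bose_gap, sum_n_m_1_S, sum_n_m_1_0.
  change (INR 1) with 1. rewrite Rmult_1_l.
  assert (Hq := exp_neg_lt_1 t Ht).
  assert (HQ := exp_gt_1 t Ht).
  assert (H1 : bose_primitive (INR 2 * t) <= 0).
  { unfold bose_primitive. generalize (exp_neg_lt_1 (INR 2 * t) ltac:(simpl; lra)).
    intros H. rewrite <- ln_1. apply ln_le; lra. }
  assert (H2 : - bose_primitive t <= bose t).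
  { unfold bose_primitive. rewrite <- ln_Rinv by lra.
    replace (/ (1 - exp (- t))) with (bose t + 1)
      by (unfold bose; rewrite exp_Ropp; field; lra).
    generalize (ln_le_minus_1 (bose t + 1)), (bose_pos t Ht). lra. }
  assert ((bose_primitive (INR 2 * t) - bose_primitive t) * / t <= bose t * / t).
  { apply Rmult_le_compat_r; [apply Rlt_le, Rinv_0_lt_compat, Ht | lra]. }
  unfold Rdiv. lra.
Qed.

(** * Return to the variable q and the theorem *)

(** Uses f(t) = q/(1-q) and ln q = -t. The free [k] serves the proved constants as well as [lambda]
    and [mu]. *)
Lemma series_excess (t k : R) :
  0 < t ->
  Series (fun n => divisor_count (S n) * exp (- t) ^ S n)
  - (k * (exp (- t) / (1 - exp (- t)) ^ 2)
     + ln (1 - exp (- t)) / ((1 - exp (- t)) * ln (exp (- t))))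
  = (excess t - k * bose t) * / (1 - exp (- t)).
Proof.
  intros Ht. assert (Hq := exp_neg_lt_1 t Ht). assert (HQ := exp_gt_1 t Ht).
  replace (bose t) with (exp (- t) / (1 - exp (- t)))
    by (unfold bose; rewrite exp_Ropp; field; lra).
  unfold excess, bose_primitive. rewrite ln_exp. field. lra.
Qed.

Lemma lt_series_iff (t k : R) :
  0 < t ->
  k * (exp (- t) / (1 - exp (- t)) ^ 2)
  + ln (1 - exp (- t)) / ((1 - exp (- t)) * ln (exp (- t)))
  < Series (fun n => divisor_count (S n) * exp (- t) ^ S n)
  <-> k * bose t < excess t.
Proof.
  intros Ht. assert (E := series_excess t k Ht).
  assert (P : 0 < / (1 - exp (- t)))
    by (apply Rinv_0_lt_compat; generalize (exp_neg_lt_1 t Ht); lra).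
  split; intros H.
  - apply Rminus_lt_0, (Rmult_lt_reg_r _ _ _ P). lra.
  - apply Rlt_0_minus, (Rmult_lt_compat_r _ _ _ P) in H. lra.
Qed.

Lemma series_lt_iff (t k : R) :
  0 < t ->
  Series (fun n => divisor_count (S n) * exp (- t) ^ S n)
  < k * (exp (- t) / (1 - exp (- t)) ^ 2)
    + ln (1 - exp (- t)) / ((1 - exp (- t)) * ln (exp (- t)))
  <-> excess t < k * bose t.
Proof.
  intros Ht. assert (E := series_excess t k Ht).
  assert (P : 0 < / (1 - exp (- t)))
    by (apply Rinv_0_lt_compat; generalize (exp_neg_lt_1 t Ht); lra).
  split; intros H.
  - apply (Rmult_lt_reg_r _ _ _ P). lra.
  - apply (Rmult_lt_compat_r _ _ _ P) in H. lra.
Qed.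

Theorem theorem4p3 :
  (forall q : R, 0 < q < 1 ->
     ex_series (fun n : nat =>
       sum_n_m (fun j : nat => INR (num_divisors j)) 1 (S n) * q ^ (S n)) /\
     euler_gamma * (q / (1 - q) ^ 2) + ln (1 - q) / ((1 - q) * ln q)
     < Series (fun n : nat =>
         sum_n_m (fun j : nat => INR (num_divisors j)) 1 (S n) * q ^ (S n))
     < q / (1 - q) ^ 2 + ln (1 - q) / ((1 - q) * ln q)) /\
  (forall lambda mu : R,
     (forall q : R, 0 < q < 1 ->
        lambda * (q / (1 - q) ^ 2) + ln (1 - q) / ((1 - q) * ln q)
        < Series (fun n : nat =>
            sum_n_m (fun j : nat => INR (num_divisors j)) 1 (S n) * q ^ (S n))
        < mu * (q / (1 - q) ^ 2) + ln (1 - q) / ((1 - q) * ln q)) ->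
     lambda <= euler_gamma /\ mu >= 1).
Proof.
  split.
  (* [Series] is total, so convergence is settled first. *)
  - intros q Hq. split; [exact (ex_series_divisor_count q Hq) |].
    assert (Ht : 0 < - ln q) by (rewrite <- ln_Rinv, <- ln_1 by lra;
      apply ln_increasing; [lra | rewrite <- Rinv_1; apply Rinv_lt_contravar; lra]).
    replace q with (exp (- - ln q)) by (rewrite Ropp_involutive; apply exp_ln; lra).
    set (t := - ln q) in *. split.
    + apply (lt_series_iff t), excess_gt; exact Ht.
    + rewrite <- (Rmult_1_l (exp (- t) / (1 - exp (- t)) ^ 2)).
      apply (series_lt_iff t); [exact Ht |]. rewrite Rmult_1_l. apply excess_lt, Ht.
  - intros lambda mu H.
    assert (H' : forall t, 0 < t -> lambda * bose t < excess t < mu * bose t).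
    { intros t Ht. destruct (H _ (exp_neg_lt_1 t Ht)) as [H1 H2].
      split; [apply lt_series_iff | apply series_lt_iff]; assumption. }
    split.
    + assert (HM : forall M,
        lambda <= harmonic M - ln (INR (S M)) + / INR (S M)).
      { intros M. apply le_epsilon. intros e He.
        assert (0 <= INR M) by apply pos_INR.
        (* The choice t = e/(M+1) makes the error M t smaller than [e]. *)
        assert (Ht : 0 < e / INR (S M))
          by (apply Rdiv_lt_0_compat; [| rewrite S_INR]; lra).
        destruct (H' _ Ht) as [H1 _]. assert (H2 := excess_near_0 _ M Ht).
        assert (H3 : lambda < harmonic M - ln (INR (S M)) + / INR (S M)
                              + INR M * (e / INR (S M))).
        { apply (Rmult_lt_reg_l _ _ _ (bose_pos _ Ht)). lra. }
        assert (E : INR M * (e / INR (S M)) = e - e / INR (S M))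
          by (rewrite S_INR; field; lra).
        lra. }
      rewrite <- (Rplus_0_r euler_gamma).
      apply (is_lim_seq_le (fun _ => lambda) _ lambda (euler_gamma + 0) HM).
      * apply is_lim_seq_const.
      * apply is_lim_seq_plus'; [apply euler_gamma_lim_shift |].
        apply (is_lim_seq_incr_1 (fun N => / INR N)).
        apply (is_lim_seq_inv INR p_infty); [apply is_lim_seq_INR | discriminate].
    + apply Rle_ge, le_epsilon. intros e He.
      (* At t = 1/e the lower bound of [excess_near_infinity] is [bose t * (1 - e)]. *)
      assert (Ht : 0 < / e) by (apply Rinv_0_lt_compat, He).
      destruct (H' _ Ht) as [_ H1]. assert (H2 := excess_near_infinity _ Ht).
      rewrite Rinv_inv in H2.
      assert (1 - e < mu); [| lra].
      apply (Rmult_lt_reg_l _ _ _ (bose_pos _ Ht)). lra.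
Qed.
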